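(* Let $T:\mathcal{H}\to\mathcal{H}$ and $j\in J$. (i) The inclusion $F^{j}(T)\subseteq\operatorname{Fix}^{j}T$ holds. (ii) If $T$ is $j$-QNE, then the converse inclusion $\operatorname{Fix}^{j}T\subseteq F^{j}(T)$ is also true. Consequently, for a CW-QNE operator $T$, $$\operatorname{Fix}T=\bigcap_{j=1}^n\operatorname{Fix}^{j}T=\bigcap_{j=1}^nF^{j}(T)=\prod_{j=1}^nF_j(T).$$ (iii) If $T$ is a CW-cutter (respectively CW-QNE, CW-SQNE, CW-sQNE), then $T$ is a cutter (respectively QNE, SQNE, sQNE).
   Context: Let $n\ge 2$, $J:=\{1,\dots,n\}$, and let $\mathcal{H}_j$, $j\in J$, be real Hilbert spaces with inner products $\langle\cdot,\cdot\rangle_j$ and norms $\|\cdot\|_j$. $\mathcal{H}:=\mathcal{H}_1\times\cdots\times\mathcal{H}_n$ is the product Hilbert space with $\langle x,y\rangle=\sum_j\langle x_j,y_j\rangle_j$ and $\|x\|^2=\sum_j\|x_j\|_j^2$. For $T:\mathcal{H}\to\mathcal{H}$ write $T(x)=((T(x))_1,\dots,(T(x))_n)$, $(T(x))_j\in\mathcal{H}_j$. $\operatorname{Fix}T=\{z\mid T(z)=z\}$ and $\operatorname{Fix}^{j}T:=\{z\in\mathcal{H}\mid(T(z))_j=z_j\}$. Define $$F^{j}(T):=\{z\in\mathcal{H}\mid\|(T(x))_j-z_j\|_j\le\|x_j-z_j\|_j\text{ for all }x\in\mathcal{H}\},$$ $$F_j(T):=\{z_j\in\mathcal{H}_j\mid\|(T(x))_j-z_j\|_j\le\|x_j-z_j\|_j\text{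 for all }x\in\mathcal{H}\}.$$ Componental properties (each requires $\operatorname{Fix}^{j}T\ne\emptyset$): $T$ is - a $j$-cutter if $\langle x_j-(T(x))_j,z_j-(T(x))_j\rangle_j\le0$ for all $x\in\mathcal{H}$, $z\in\operatorname{Fix}^{j}T$; - $j$-QNE if $\|(T(x))_j-z_j\|_j\le\|x_j-z_j\|_j$ for all $x\in\mathcal{H}$, $z\in\operatorname{Fix}^{j}T$; - $j$-SQNE if there is $\rho_j>0$ with $\|(T(x))_j-z_j\|_j^2\le\|x_j-z_j\|_j^2-\rho_j\|(T(x))_j-x_j\|_j^2$ for all $x\in\mathcal{H}$, $z\in\operatorname{Fix}^{j}T$; - $j$-sQNE if $\|(T(x))_j-z_j\|_j<\|x_j-z_j\|_j$ for all $x\notin\operatorname{Fix}^{j}T$, $z\in\operatorname{Fix}^{j}T$. $T$ is a CW-cutter (CW-QNE, CW-SQNE, CW-sQNE) if it is a $j$-cutter ($j$-QNE, $j$-SQNE, $j$-sQNE) for all $j\in J$. The usual (global) properties cutter, QNE (quasi-nonexpansive), SQNE (strongly quasi-nonexpansive), sQNE (strictly quasi-nonexpansive) require $\operatorname{Fix}T\neq\emptyset$ and, respectively: $\langle x-T(x),z-T(x)\rangle\le0$ for all $x\in\mathcal{H}$, $z\in\operatorname{Fix}T$; $\|T(x)-z\|\le\|x-z\|$ for all such $x,z$; there is $\rho>0$ with $\|T(x)-z\|^2\le\|x-z\|^2-\rho\|T(x)-x\|^2$ for all such $x,z$; $\|T(x)-z\|<\|x-z\|$ for all $x\notin\operatorname{Fix}T$,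 $z\in\operatorname{Fix}T$. *)

(* Defs.v *)
From HB Require Import structures.
From mathcomp Require Import all_boot all_order all_algebra.
From mathcomp Require Import all_classical all_reals all_analysis.
From mathcomp Require Import ring.
Set Implicit Arguments.
Unset Strict Implicit.
Unset Printing Implicit Defensive.
Import Order.TTheory GRing.Theory Num.Theory.
Import numFieldNormedType.Exports.
Local Open Scope classical_set_scope.
Local Open Scope ring_scope.

HB.mixin Record CompleteNormedModule_isHilbert (R : realType) V
    & CompleteNormedModule R V := {
  inner : {dot V for idfun} ;
  sqr_normr_inner : forall x : V, `|x| ^+ 2 = inner x x
}.

#[short(type="hilbertType")]
HB.structure Definition Hilbert (R : realType) :=
  {V of CompleteNormedModule R V & CompleteNormedModule_isHilbert R V}.

Section dot_norm.
Context (R : rcfType) (U : lmodType R) (f : {dot U for idfun}).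
Implicit Types u v : U.

Lemma dotC u v : f u v = f v u.
Proof. by rewrite [LHS]hermitian_subproof expr0 mul1r. Qed.

Let fDl w u v : f (u + v) w = f u w + f v w.
Proof. by rewrite linearDl. Qed.
Let fZl w a u : f (a *: u) w = a * f u w.
Proof. exact: linearZl_LR. Qed.

Lemma dot_ge0 u : 0 <= f u u.
Proof.
have [->|/neq0_dnorm_gt0/ltW//] := eqVneq u 0.
by rewrite linear0l.
Qed.

Lemma dot_CauchySchwarz u v : f u v ^+ 2 <= f u u * f v v.
Proof.
have [->|v0] := eqVneq v 0.
  by rewrite dotC linear0l expr0n/= dotC linear0l mulr0.
have fv0 : 0 < f v v by exact: neq0_dnorm_gt0.
have := dot_ge0 (f v v *: u + (- f u v) *: v).
have -> : f (f v v *: u + - f u v *: v) (f v v *: u + - f u v *: v) =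
          f v v * (f u u * f v v - f u v ^+ 2).
  rewrite fDl !fZl (dotC u (_ + _)) (dotC v (_ + _)) !fDl !fZl (dotC v u).
  by ring.
by rewrite pmulr_rge0// subr_ge0.
Qed.

Definition dot_norm u : R := Num.sqrt (f u u).

Lemma dot_normD u v : dot_norm (u + v) <= dot_norm u + dot_norm v.
Proof.
rewrite -ler_sqr ?nnegrE ?addr_ge0 ?sqrtr_ge0//.
rewrite sqrrD !sqr_sqrtr ?dot_ge0// fDl !(dotC _ (_ + _)) !fDl.
rewrite (dotC v u) addrA lerD2r -addrA lerD2l -mulr2n lerMn2r/=.
apply: le_trans (ler_norm _) _; rewrite -sqrtr_sqr -sqrtrM ?dot_ge0//.
by rewrite ler_wsqrtr// dot_CauchySchwarz.
Qed.

Lemma dot_normZ a u : dot_norm (a *: u) = `|a| * dot_norm u.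
Proof.
rewrite /dot_norm fZl dotC fZl mulrA -expr2 sqrtrM ?sqr_ge0//.
by rewrite sqrtr_sqr.
Qed.

Lemma dot_norm0_eq0 u : dot_norm u = 0 -> u = 0.
Proof.
move=> /eqP; rewrite sqrtr_eq0; apply: contraTeq => /neq0_dnorm_gt0 u0.
by rewrite -ltNge.
Qed.

End dot_norm.

(* An alias, so that the Hilbert structure below does not compete with the
   topologies already attached to function types. *)
Definition hprod (R : realType) (I : finType) (H : I -> hilbertType R) : Type :=
  forall i, H i.

Section hprod_lmodule.
Context (R : realType) (I : finType) (H : I -> hilbertType R).
Implicit Types x y z : hprod H.

HB.instance Definition _ := gen_eqMixin (hprod H).
HB.instance Definition _ := gen_choiceMixin (hprod H).

Definition hprod_add x y : hprod H := fun i => x i + y i.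
Definition hprod_opp x : hprod H := fun i => - x i.
Definition hprod_scale (a : R) x : hprod H := fun i => a *: x i.

Let addA : associative hprod_add.
Proof. by move=> x y z; apply: functional_extensionality_dep => i; exact: addrA. Qed.
Let addC : commutative hprod_add.
Proof. by move=> x y; apply: functional_extensionality_dep => i; exact: addrC. Qed.
Let add0 : left_id ((fun i => 0) : hprod H) hprod_add.
Proof. by move=> x; apply: functional_extensionality_dep => i; exact: add0r. Qed.
Let addN : left_inverse ((fun i => 0) : hprod H) hprod_opp hprod_add.
Proof. by move=> x; apply: functional_extensionality_dep => i; exact: addNr. Qed.

HB.instance Definition _ := GRing.isZmodule.Build (hprod H) addA addC add0 addN.

Let scaleA a b x : hprod_scale a (hprod_scale b x) = hprod_scale (a * b) x.
Proof. by apply: functional_extensionality_dep => i; exact: scalerA. Qed.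
Let scale1 : left_id 1 hprod_scale.
Proof. by move=> x; apply: functional_extensionality_dep => i; exact: scale1r. Qed.
Let scaleDr : right_distributive hprod_scale +%R.
Proof. by move=> a x y; apply: functional_extensionality_dep => i; exact: scalerDr. Qed.
Let scaleDl x : {morph hprod_scale^~ x : a b / a + b}.
Proof. by move=> a b; apply: functional_extensionality_dep => i; exact: scalerDl. Qed.

HB.instance Definition _ := GRing.Zmodule_isLmodule.Build R (hprod H)
  scaleA scale1 scaleDr scaleDl.

Lemma hprod0E i : (0 : hprod H) i = 0. Proof. by []. Qed.
Lemma hprodDE x y i : (x + y) i = x i + y i. Proof. by []. Qed.
Lemma hprodBE x y i : (x - y) i = x i - y i. Proof. by []. Qed.
Lemma hprodZE a x i : (a *: x) i = a *: x i. Proof. by []. Qed.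

Definition hprod_inner x y : R := \sum_i inner (x i) (y i).

Let hprod_innerC x y : hprod_inner x y = hprod_inner y x.
Proof. by apply: eq_bigr => i _; rewrite dotC. Qed.

Let hprod_inner_linear y :
  GRing.linear_for ( *%R : R -> R -> R) (hprod_inner ^~ y).
Proof.
move=> a x x'; rewrite /hprod_inner mulr_sumr -big_split/=.
by apply: eq_bigr => i _; rewrite linearDl linearZl_LR.
Qed.

Let hprod_inner_bilinear :
  bilinear_for ( *%R : GRing.Scale.law R R) (idfun \; *%R : GRing.Scale.law R R)
    hprod_inner.
Proof.
split=> x; first exact: hprod_inner_linear.
by move=> a y z; rewrite !(hprod_innerC x) hprod_inner_linear.
Qed.

HB.instance Definition _ := bilinear_isBilinear.Build R (hprod H) (hprod H) R
  _ _ hprod_inner hprod_inner_bilinear.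

Let hprod_inner_hermitian x y :
  hprod_inner x y = (-1) ^+ false * idfun (hprod_inner y x).
Proof. by rewrite expr0 mul1r hprod_innerC. Qed.

HB.instance Definition _ := isHermitianSesquilinear.Build R (hprod H) false idfun
  hprod_inner hprod_inner_hermitian.

Let hprod_inner_gt0 x : x != 0 -> 0 < hprod_inner x x.
Proof.
move=> x0; rewrite lt0r sumr_ge0 ?andbT => [|i _]; last exact: dot_ge0.
apply: contra x0; rewrite psumr_eq0 => [/allP xx0|i _]; last exact: dot_ge0.
apply/eqP/functional_extensionality_dep => i; apply/eqP.
have /implyP/(_ isT) := xx0 i (mem_index_enum i).
by apply: contraTT => xi0; rewrite gt_eqF//; exact: neq0_dnorm_gt0.
Qed.

HB.instance Definition _ := isDotProduct.Build R (hprod H) hprod_inner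
  hprod_inner_gt0.

End hprod_lmodule.

Section hprod_hilbert.
Context (R : realType) (I : finType) (H : I -> hilbertType R).
Implicit Types x y z : hprod H.

Let pinner : {dot (hprod H) for idfun} := @hprod_inner R I H.

HB.instance Definition _ := @Lmodule_isNormed.Build R (hprod H)
  (dot_norm pinner) (dot_normD pinner) (dot_normZ pinner)
  (@dot_norm0_eq0 _ _ pinner).

Lemma hprod_sqr_normr x : `|x| ^+ 2 = hprod_inner x x.
Proof. by rewrite [LHS]sqr_sqrtr// (dot_ge0 pinner). Qed.

Lemma hprod_sqr_normrE x : `|x| ^+ 2 = \sum_i `|x i| ^+ 2.
Proof.
by rewrite hprod_sqr_normr; apply: eq_bigr => i _; rewrite sqr_normr_inner.
Qed.

Lemma hprod_le_normr x i : `|x i| <= `|x|.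
Proof.
rewrite -ler_sqr ?nnegrE// hprod_sqr_normrE (bigD1 i)//= lerDl.
by apply: sumr_ge0 => j _; exact: sqr_ge0.
Qed.

Lemma hprod_normr_le x : `|x| <= \sum_i `|x i|.
Proof.
rewrite -ler_sqr ?nnegrE ?sumr_ge0// hprod_sqr_normrE.
apply: (@proj2 (0 <= \sum_i `|x i|)).
apply: (big_ind2 (fun s t : R => 0 <= t /\ s <= t ^+ 2)) => //.
move=> a a' b b' [a0 aa'] [b0 bb']; split; first exact: addr_ge0.
rewrite sqrrD addrAC; apply: le_trans (lerD aa' bb') _.
by rewrite lerDl mulrn_wge0// mulr_ge0.
Qed.

Let hprod_complete (F : set_system (hprod H)) :
  ProperFilter F -> cauchy F -> cvg F.
Proof.
move=> FF /cauchyP Fc.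
have cvF i : cvg ((fun x : hprod H => x i) @ F).
  apply: cauchy_cvg; apply/cauchyP => e /Fc[x Fx]; exists (x i).
  suff : ball x e `<=` (fun y => ball (x i) e (y i)) by move/filterS; apply.
  move=> y; rewrite -!ball_normE/=; exact: le_lt_trans (hprod_le_normr (x - y) i).
apply/cvg_ex; exists (fun i => lim ((fun x : hprod H => x i) @ F)).
apply/cvgrPdist_le => e e0.
have d0 : 0 < e / (#|I|.+1)%:R by rewrite divr_gt0.
have : \forall x \near F, forall i : I,
    `|lim ((fun x : hprod H => x i) @ F) - x i| <= e / (#|I|.+1)%:R.
  apply: filter_forall => i.
  by move/cvgrPdist_le : (cvF i) => /(_ _ d0).
apply: filterS => x xl; apply: le_trans (hprod_normr_le _) _.
apply: (@le_trans _ _ (\sum_(i : I) e / (#|I|.+1)%:R)).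
  by apply: ler_sum => i _; exact: xl.
by rewrite sumr_const -[leLHS]mulr_natr mulrAC ler_pdivrMr// ler_pM2l// ler_nat.
Qed.

HB.instance Definition _ := Uniform_isComplete.Build (hprod H) hprod_complete.

HB.instance Definition _ :=
  CompleteNormedModule_isHilbert.Build R (hprod H) hprod_sqr_normr.

End hprod_hilbert.

Section global.
Context (R : realType) (E : hilbertType R).
Implicit Types T : E -> E.

Definition Fix_pts T : set E := [set z | T z = z].

Definition cutter T : Prop :=
  Fix_pts T !=set0 /\
  forall x z, Fix_pts T z -> inner (x - T x) (z - T x) <= 0.

Definition QNE T : Prop :=
  Fix_pts T !=set0 /\
  forall x z, Fix_pts T z -> `|T x - z| <= `|x - z|.

Definition SQNE T : Prop :=
  Fix_pts T !=set0 /\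
  exists2 rho : R, 0 < rho & forall x z, Fix_pts T z ->
    `|T x - z| ^+ 2 <= `|x - z| ^+ 2 - rho * `|T x - x| ^+ 2.

(* s for strictly, as opposed to S for strongly in SQNE *)
Definition sQNE T : Prop :=
  Fix_pts T !=set0 /\
  forall x z, ~ Fix_pts T x -> Fix_pts T z -> `|T x - z| < `|x - z|.

End global.

Section componental.
Context (R : realType) (n : nat) (H : 'I_n -> hilbertType R).
Implicit Types (T : hprod H -> hprod H) (j : 'I_n).

Definition Fixj j T : set (hprod H) := [set z | T z j = z j].

(* F^j(T), a subset of the product space *)
Definition Fsup j T : set (hprod H) :=
  [set z | forall x : hprod H, `|T x j - z j| <= `|x j - z j|].

(* F_j(T), a subset of the j-th factor *)
Definition Fsub j T : set (H j) :=
  [set zj | forall x : hprod H, `|T x j - zj| <= `|x j - zj|].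

Definition hprod_set (A : forall j, set (H j)) : set (hprod H) :=
  [set z | forall j, A j (z j)].

Definition j_cutter j T : Prop :=
  Fixj j T !=set0 /\
  forall x z, Fixj j T z -> inner (x j - T x j) (z j - T x j) <= 0.

Definition j_QNE j T : Prop :=
  Fixj j T !=set0 /\
  forall x z, Fixj j T z -> `|T x j - z j| <= `|x j - z j|.

Definition j_SQNE j T : Prop :=
  Fixj j T !=set0 /\
  exists2 rho : R, 0 < rho & forall x z, Fixj j T z ->
    `|T x j - z j| ^+ 2 <= `|x j - z j| ^+ 2 - rho * `|T x j - x j| ^+ 2.

Definition j_sQNE j T : Prop :=
  Fixj j T !=set0 /\
  forall x z, ~ Fixj j T x -> Fixj j T z -> `|T x j - z j| < `|x j - z j|.

Definition CW_cutter T : Prop := forall j, j_cutter j T.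
Definition CW_QNE T : Prop := forall j, j_QNE j T.
Definition CW_SQNE T : Prop := forall j, j_SQNE j T.
Definition CW_sQNE T : Prop := forall j, j_sQNE j T.

End componental.

Arguments Fsub {R n H} j T _.

(* Main.v *)
Require Import Defs.
From mathcomp Require Import all_boot all_order all_algebra.
From mathcomp Require Import all_classical all_reals all_analysis.
Import Order.TTheory GRing.Theory Num.Theory.
Local Open Scope classical_set_scope.
Local Open Scope ring_scope.

(** Each componental inequality involves [z] only through [z j].  Points
    [z^j] of the sets [Fixj j T] can therefore be glued into one [z] with
    [z j = z^j j] that still satisfies all the inequalities, and testing them
    at [x = z] gives [T z = z].  The global inequalities are then sums over
    [j] of the componental ones. *)

Section componental_to_global.
Context (R : realType) (n : nat) (H : 'I_n -> hilbertType R).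
Implicit Types (T : hprod H -> hprod H) (x y z : hprod H).

Lemma hprod_innerE x y : inner x y = \sum_i inner (x i) (y i).
Proof. by []. Qed.

Lemma Fix_ptsE T z : Fix_pts T z <-> forall j, Fixj j T z.
Proof.
split=> [Tz j|Tz]; first by rewrite /Fixj/= Tz.
exact/functional_extensionality_dep/Tz.
Qed.

(** Testing the defining inequality at [x = z] makes its right-hand side vanish. *)
Lemma Fsup_sub_Fixj T j : Fsup j T `<=` Fixj j T.
Proof.
move=> z /(_ z); rewrite subrr normr0 normr_le0 subr_eq0.
by move/eqP.
Qed.

Lemma Fixj_sub_Fsup T j : j_QNE j T -> Fixj j T `<=` Fsup j T.
Proof. by move=> [_ qT] z Tz x; exact: qT. Qed.

(** The values [a] chosen for different [j] do not interfere, because the hypothesis leaves the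
    other coordinates of [z] free. *)
Lemma glued_Fix_pts_neq0 T :
  (forall j, exists a : H j, forall z, z j = a -> T z j = z j) ->
  Fix_pts T !=set0.
Proof.
move=> /(_ _)/cid aT.
exists (fun j => sval (aT j)); apply/Fix_ptsE => j.
exact: (svalP (aT j)).
Qed.

Lemma cutter_of_CW T : CW_cutter T -> cutter T.
Proof.
move=> cT; split.
  apply: glued_Fix_pts_neq0 => j; have [[w Tw] cTj] := cT j.
  (* At [x = z] with [z j = w j], both arguments of the inner product are [z j - T z j], whose
     squared norm is thus nonpositive. *)
  exists (w j) => z zw; have := cTj z w Tw; rewrite -zw -sqr_normr_inner => le0.
  apply/esym/eqP; rewrite -subr_eq0 -normr_eq0 -sqrf_eq0.
  by rewrite eq_le le0 sqr_ge0.
move=> x z /Fix_ptsE Tz; rewrite hprod_innerE; apply: sumr_le0 => j _.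
by have [_] := cT j; apply.
Qed.

Lemma QNE_of_CW T : CW_QNE T -> QNE T.
Proof.
move=> qT; split.
  apply: glued_Fix_pts_neq0 => j; have [[w Tw] qTj] := qT j.
  (* Membership in [Fsup j T] depends on [z j] alone, so it passes from [w] to [z]. *)
  exists (w j) => z zw; apply: Fsup_sub_Fixj => x; rewrite zw; exact: qTj.
move=> x z /Fix_ptsE Tz.
rewrite -ler_sqr ?nnegrE// !hprod_sqr_normrE; apply: ler_sum => j _.
by rewrite ler_sqr ?nnegrE//; have [_] := qT j; apply.
Qed.

Lemma j_SQNE_QNE T j : j_SQNE j T -> j_QNE j T.
Proof.
move=> [T0 [rho rho0 sT]]; split=> // x z Tz.
rewrite -ler_sqr ?nnegrE//; apply: le_trans (sT _ _ Tz) _.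
by rewrite gerBl mulr_ge0 ?sqr_ge0 ?ltW.
Qed.

Lemma j_sQNE_QNE T j : j_sQNE j T -> j_QNE j T.
Proof.
move=> [T0 sT]; split=> // x z Tz.
have [Tx|Tx] := pselect (Fixj j T x); first by rewrite Tx.
exact/ltW/sT.
Qed.

Lemma SQNE_of_CW T : CW_SQNE T -> SQNE T.
Proof.
move=> sT; split; first by have [] := QNE_of_CW _ (fun j => j_SQNE_QNE _ _ (sT j)).
have /(_ _)/cid rhoP : forall j, exists rho : R, 0 < rho /\
    forall x z, Fixj j T z ->
    `|T x j - z j| ^+ 2 <= `|x j - z j| ^+ 2 - rho * `|T x j - x j| ^+ 2.
  by move=> j; have [_ [rho rho0 rhoT]] := sT j; exists rho.
(* The least componental constant serves all coordinates. The default 1 keeps the minimum positive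
   and can only lower it, which weakens the bound. *)
exists (\big[Num.min/1]_j sval (rhoP j)).
  apply: lt_bigmin => // j _; exact: (svalP (rhoP j)).1.
move=> x z /Fix_ptsE Tz; rewrite !hprod_sqr_normrE mulr_sumr -sumrB.
apply: ler_sum => j _; apply: le_trans ((svalP (rhoP j)).2 _ _ (Tz j)) _.
by rewrite lerD2l lerN2 ler_wpM2r ?sqr_ge0// bigmin_le_cond.
Qed.

Lemma sQNE_of_CW T : CW_sQNE T -> sQNE T.
Proof.
move=> sT; have qT j := j_sQNE_QNE _ _ (sT j).
split; first by have [] := QNE_of_CW _ qT.
move=> x z Tx /Fix_ptsE Tz.
(* A coordinate moved by [T] gives one strict term in the sum; the other terms need only the weak
   inequality. *)
have [j Txj] : exists j, ~ Fixj j T x.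
  by apply/existsNP => /Fix_ptsE.
rewrite -ltr_sqr ?nnegrE// !hprod_sqr_normrE (bigD1 j)//= [ltRHS](bigD1 j)//=.
apply: ltr_leD; first by rewrite ltr_sqr ?nnegrE//; have [_] := sT j; apply.
apply: ler_sum => i _; rewrite ler_sqr ?nnegrE//.
by have [_] := qT i; apply.
Qed.

End componental_to_global.

Theorem fact14 (R : realType) (n : nat) (hn : (2 <= n)%N)
    (H : 'I_n -> hilbertType R) (T : hprod H -> hprod H) (j : 'I_n) :
  Fsup j T `<=` Fixj j T /\
  ((j_QNE j T -> Fixj j T `<=` Fsup j T) /\
   (CW_QNE T ->
     [/\ Fix_pts T = \bigcap_(i in [set: 'I_n]) Fixj i T,
         \bigcap_(i in [set: 'I_n]) Fixj i T =
           \bigcap_(i in [set: 'I_n]) Fsup i T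
       & \bigcap_(i in [set: 'I_n]) Fsup i T =
           hprod_set (fun i => Fsub i T)])) /\
  [/\ CW_cutter T -> cutter T,
      CW_QNE T -> QNE T,
      CW_SQNE T -> SQNE T
    & CW_sQNE T -> sQNE T].
Proof.
split; first exact: Fsup_sub_Fixj.
split; last first.
  split; [exact: cutter_of_CW|exact: QNE_of_CW|exact: SQNE_of_CW|].
  exact: sQNE_of_CW.
split=> [|qT]; first exact: Fixj_sub_Fsup.
split.
- apply/seteqP; split=> [z /Fix_ptsE Tz i _|z Tz]; first exact: Tz.
  by apply/Fix_ptsE => i; exact: Tz.
- apply: eq_bigcapr => i _; apply/seteqP; split; last exact: Fsup_sub_Fixj.
  exact: Fixj_sub_Fsup.
(* [Fsup i T] constrains only the coordinate [z i], so both sides unfold to the same condition. *)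
- by apply/seteqP; split=> [z Tz i|z Tz i _]; exact: Tz.
Qed.
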